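(* The following assertion is false in general: ''for every commutative ring $A$, every finitely generated ideal $I$ of $A$ and every $A$-module $M$, one has $\operatorname{p\text{-}grade}_I(M)<\infty$ if and only if $IM\neq M$.'' Specifically, let $A=\mathbb{Z}$, $I=2\mathbb{Z}$, and $M=\{a/2^n+\mathbb{Z}\mid a\in\mathbb{Z},\ n\geq 0\}\subset\mathbb{Q}/\mathbb{Z}$. Then $IM=M$ but $\operatorname{p\text{-}grade}_I(M)=0$.
   Context: All rings are commutative with identity. For a ring $R$ and an $R$-module $N$, a finite sequence $r_1,\dots,r_k\in R$ is a weak $N$-sequence if, for each $i$, the element $r_i$ is a non-zero-divisor on $N/(r_1,\dots,r_{i-1})N$ (every element is a non-zero-divisor on the zero module). For an ideal $J\subset R$, $\operatorname{grade}_J(N)\in\{0,1,2,\dots\}\cup\{\infty\}$ is the supremum of the lengths of weak $N$-sequences contained in $J$. The polynomial grade is $\operatorname{p\text{-}grade}_I M=\lim_{n\to\infty}\operatorname{grade}_{IA[X_1,\dots,X_n]}(M[X_1,\dots,X_n])$, where $M[X_1,\dots,X_n]=M\otimes_A A[X_1,\dots,X_n]$. *)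

(* Defs.v *)
From HB Require Import structures.
From mathcomp Require Import all_boot all_order all_algebra.
From mathcomp Require Import boolp classical_sets.
From mathcomp Require Import reals ereal topology normedtype sequences.
From mathcomp Require Import ring.
From mathcomp.multinomials Require Import freeg.
From mathcomp.multinomials Require mpoly.
(* The polynomial notations of mpoly clash with those of topology. *)
Import -(notations) mpoly.

Set Implicit Arguments.
Unset Strict Implicit.
Unset Printing Implicit Defensive.

Import Order.TTheory GRing.Theory Num.Theory.
Local Open Scope ring_scope.
Local Open Scope classical_set_scope.
Local Open Scope quotient_scope.

Section GeneratedSubmodule.
Context (R : pzRingType) (V : lmodType R).
Implicit Types X : set V.

Definition submod_gen X : set V := [set v | exists (n : nat) (a : 'I_n -> R)
  (x : 'I_n -> V), (forall i, X (x i)) /\ v = \sum_i a i *: x i].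

Lemma submod_gen0 X : submod_gen X 0.
Proof.
exists 0, (fun=> 0), (fun=> 0); split; first by case.
by rewrite big_ord0.
Qed.

Lemma submod_genD X u v :
  submod_gen X u -> submod_gen X v -> submod_gen X (u + v).
Proof.
move=> [m [a [x [Xx ->]]]] [n [b [y [Xy ->]]]].
exists (m + n)%N, (fun i => match split i with inl j => a j | inr k => b k end),
  (fun i => match split i with inl j => x j | inr k => y k end); split.
  by move=> i; case: split.
rewrite big_split_ord /=; congr (_ + _); apply: eq_bigr => i _.
  by rewrite (unsplitK (inl i)).
by rewrite (unsplitK (inr i)).
Qed.

Lemma submod_genZ X c v : submod_gen X v -> submod_gen X (c *: v).
Proof.
move=> [n [a [x [Xx ->]]]]; exists n, (fun i => c * a i), x; split => //.
by rewrite scaler_sumr; apply: eq_bigr => i _; rewrite scalerA.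
Qed.

Lemma submod_gen_sub X v : X v -> submod_gen X v.
Proof.
move=> Xv; exists 1, (fun=> 1), (fun=> v); split => //.
by rewrite big_ord1 scale1r.
Qed.

Definition submod_gen_pred X : {pred V} := fun v => `[< submod_gen X v >].

Lemma submod_gen_closed X : GRing.submod_closed (submod_gen_pred X).
Proof.
split=> [|c u v /asboolP Xu /asboolP Xv]; apply/asboolP.
  exact: submod_gen0.
exact/submod_genD/Xv/submod_genZ.
Qed.

HB.instance Definition _ X :=
  GRing.isSubmodClosed.Build R V (submod_gen_pred X) (submod_gen_closed X).

(* V / <X>, the quotient by the submodule generated by X *)
Definition quotmod X := Quotient.quot (submod_gen_pred X).

HB.instance Definition _ X := GRing.Zmodule.on (quotmod X).

Definition quotmod_pi X (v : V) : quotmod X :=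
  \pi_(Quotient.quot (submod_gen_pred X)) v.

Lemma quotmod_eqP X u v :
  quotmod_pi X u = quotmod_pi X v <-> submod_gen X (u - v).
Proof.
rewrite /quotmod_pi; split=> [/eqP|Xuv]; last apply/eqP.
  by rewrite -Quotient.idealrBE => /asboolP.
by rewrite -Quotient.idealrBE; apply/asboolP.
Qed.

Lemma quotmod_piD X : {morph quotmod_pi X : u v / u + v}.
Proof. by move=> u v; rewrite /quotmod_pi raddfD. Qed.

Lemma quotmodW X (P : quotmod X -> Prop) :
  (forall v, P (quotmod_pi X v)) -> forall q, P q.
Proof. by move=> PX q; rewrite -[q]reprK; apply: PX. Qed.

Definition quotmod_scale X c (q : quotmod X) : quotmod X :=
  quotmod_pi X (c *: (repr q : V)).

Lemma quotmod_scaleE X c v :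
  quotmod_scale c (quotmod_pi X v) = quotmod_pi X (c *: v).
Proof.
apply/quotmod_eqP; rewrite -scalerBr; apply: submod_genZ.
by apply/quotmod_eqP; rewrite /quotmod_pi reprK.
Qed.

Lemma quotmod_scaleA X a b (q : quotmod X) :
  quotmod_scale a (quotmod_scale b q) = quotmod_scale (a * b) q.
Proof. by elim/quotmodW: q => v; rewrite !quotmod_scaleE scalerA. Qed.

Lemma quotmod_scale1 X : left_id 1 (@quotmod_scale X).
Proof. by elim/quotmodW=> v; rewrite quotmod_scaleE scale1r. Qed.

Lemma quotmod_scaleDr X : right_distributive (@quotmod_scale X) +%R.
Proof.
move=> a; elim/quotmodW=> u; elim/quotmodW=> v.
by rewrite -quotmod_piD !quotmod_scaleE scalerDr quotmod_piD.
Qed.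

Lemma quotmod_scaleDl X q : {morph (@quotmod_scale X)^~ q : a b / a + b}.
Proof.
by move=> a b; elim/quotmodW: q => v; rewrite !quotmod_scaleE scalerDl quotmod_piD.
Qed.

HB.instance Definition _ X := GRing.Zmodule_isLmodule.Build R (quotmod X)
  (@quotmod_scaleA X) (@quotmod_scale1 X) (@quotmod_scaleDr X)
  (@quotmod_scaleDl X).

End GeneratedSubmodule.

Section Ideals.
Context (R : comNzRingType).

Definition ideal_gen (X : set R) : set R := submod_gen (X : set R^o).

Definition fg_ideal (I : set R) := exists s : seq R, I = ideal_gen [set` s].

(* These products only generate J N: they are not closed under addition. *)
Definition smul_set (J : set R) (N : lmodType R) : set N :=
  [set a *: x | a in J & x in [set: N]].
Arguments smul_set J N : clear implicits.

Definition ideal_smul (J : set R) (N : lmodType R) : set N :=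
  submod_gen (smul_set J N).

Definition nonzerodivisor (r : R) (N : lmodType R) :=
  forall x : N, r *: x = 0 -> x = 0.

Definition weak_sequence (N : lmodType R) (s : seq R) :=
  forall i, (i < size s)%N ->
    nonzerodivisor s`_i (quotmod (smul_set (ideal_gen [set` take i s]) N)).

(* The values in {0, 1, 2, ...} U {oo} are taken in the extended reals. *)
Definition grade (K : realType) (J : set R) (N : lmodType R) : \bar K :=
  ereal_sup [set ((size s)%:R : K)%:E | s in
    [set s : seq R | [set` s] `<=` J /\ weak_sequence N s]].

End Ideals.
Arguments smul_set {R} J N.
Arguments ideal_smul {R} J N.

(* M (x)_A B as the quotient of the free abelian group on M * B by the
   bilinearity relations, with B acting on the right factor *)
Section BaseChange.
Context (A : comNzRingType) (M : lmodType A) (B : comAlgType A).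

Inductive tensor_rel : set {freeg (M * B)%type} :=
| tensor_relDl m m' b :
    tensor_rel (<< (m + m', b) >> - (<< (m, b) >> + << (m', b) >>))
| tensor_relDr m b b' :
    tensor_rel (<< (m, b + b') >> - (<< (m, b) >> + << (m, b') >>))
| tensor_relZ a m b :
    tensor_rel (<< (a *: m, b) >> - << (m, a *: b) >>).

Definition tensor := quotmod tensor_rel.

HB.instance Definition _ := GRing.Zmodule.on tensor.

Definition tensor_pi : {freeg (M * B)%type} -> tensor := quotmod_pi tensor_rel.

Definition pure_tensor (m : M) (b : B) : tensor := tensor_pi << (m, b) >>.

Definition free_scale (c : B) : {freeg (M * B)%type} -> {freeg (M * B)%type} :=
  fglift (fun p => << (p.1, c * p.2) >>).

Definition tensor_scale (c : B) (t : tensor) : tensor :=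
  tensor_pi (free_scale c (repr t)).

Lemma free_scaleB c : {morph free_scale c : x y / x - y}.
Proof. exact: lift_is_additive. Qed.

Lemma free_scaleU c m b : free_scale c << (m, b) >> = << (m, c * b) >>.
Proof. by rewrite /free_scale liftU scale1r. Qed.

HB.instance Definition _ c := GRing.isZmodMorphism.Build
  {freeg (M * B)%type} {freeg (M * B)%type} (free_scale c) (@free_scaleB c).

Lemma free_ind (P : {freeg (M * B)%type} -> Prop) :
  P 0 -> (forall x y, P x -> P y -> P (x + y)) -> (forall x, P x -> P (- x)) ->
  (forall m b, P << (m, b) >>) -> forall x, P x.
Proof.
move=> P0 PD PN PU x; rewrite -[x]freeg_sumE.
elim/big_ind: _ => // -[m b] _; move: (coeff _ _) => k.
have PMn n : P (<< (m, b) >> *+ n).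
  by elim: n => [|n IHn]; rewrite ?mulr0n // mulrS; apply: PD.
have -> : << k *g (m, b) >> = << (m, b) >> *~ k :> {freeg (M * B)%type}.
  by rewrite freegU_mulz intz.
by case: k => n; [apply: PMn | apply/PN/PMn].
Qed.

Lemma tensor_piD : {morph tensor_pi : x y / x + y}.
Proof. exact: quotmod_piD. Qed.

Lemma tensor_pi0 : tensor_pi 0 = 0.
Proof. by apply: (@addrI _ (tensor_pi 0)); rewrite -tensor_piD !addr0. Qed.

Lemma tensor_piN : {morph tensor_pi : x / - x}.
Proof.
move=> x; apply: (@addrI _ (tensor_pi x)).
by rewrite -tensor_piD !subrr tensor_pi0.
Qed.

Lemma pure_tensorDl m m' b :
  pure_tensor (m + m') b = pure_tensor m b + pure_tensor m' b.
Proof.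
rewrite /pure_tensor -tensor_piD; apply/quotmod_eqP/submod_gen_sub.
exact: tensor_relDl.
Qed.

Lemma pure_tensorDr m b b' :
  pure_tensor m (b + b') = pure_tensor m b + pure_tensor m b'.
Proof.
rewrite /pure_tensor -tensor_piD; apply/quotmod_eqP/submod_gen_sub.
exact: tensor_relDr.
Qed.

Lemma pure_tensorZ a m b : pure_tensor (a *: m) b = pure_tensor m (a *: b).
Proof. by apply/quotmod_eqP/submod_gen_sub/tensor_relZ. Qed.

Lemma free_scale_rel c x :
  submod_gen tensor_rel x -> submod_gen tensor_rel (free_scale c x).
Proof.
move=> [n [a [r [rP ->]]]].
exists n, a, (fun i => free_scale c (r i)); split=> [i|].
  case: (rP i) => [m m' b|m b b'|e m b]; rewrite !raddfB ?raddfD /= !free_scaleU.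
  - by rewrite -opprD; apply: tensor_relDl.
  - by rewrite -opprD mulrDr; apply: tensor_relDr.
  - by rewrite -scalerAr; apply: tensor_relZ.
rewrite raddf_sum; apply: eq_bigr => i _.
by rewrite -[a i]intz !scaler_int raddfMz.
Qed.

Lemma tensor_scale_pi c x : tensor_scale c (tensor_pi x) = tensor_pi (free_scale c x).
Proof.
apply/quotmod_eqP; rewrite -raddfB; apply: free_scale_rel.
by apply/quotmod_eqP; rewrite /quotmod_pi reprK.
Qed.

Lemma tensorW (P : tensor -> Prop) :
  (forall x, P (tensor_pi x)) -> forall t, P t.
Proof. exact: quotmodW. Qed.

Lemma tensor_scaleDr : right_distributive tensor_scale +%R.
Proof.
move=> c; elim/tensorW=> x; elim/tensorW=> y.
by rewrite -tensor_piD !tensor_scale_pi raddfD tensor_piD.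
Qed.

Lemma tensor_scaleN c : {morph tensor_scale c : t / - t}.
Proof.
elim/tensorW=> x.
by rewrite -tensor_piN !tensor_scale_pi raddfN tensor_piN.
Qed.

Lemma tensor_scale0 c : tensor_scale c 0 = 0.
Proof. by rewrite -tensor_pi0 tensor_scale_pi raddf0. Qed.

Lemma tensor_scale_pure c m b :
  tensor_scale c (pure_tensor m b) = pure_tensor m (c * b).
Proof. by rewrite tensor_scale_pi free_scaleU. Qed.

Lemma tensor_ind (P : tensor -> Prop) :
  P 0 -> (forall s t, P s -> P t -> P (s + t)) -> (forall t, P t -> P (- t)) ->
  (forall m b, P (pure_tensor m b)) -> forall t, P t.
Proof.
move=> P0 PD PN PU; elim/tensorW; elim/free_ind => //.
- by rewrite tensor_pi0.
- by move=> x y Px Py; rewrite tensor_piD; apply: PD.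
- by move=> x Px; rewrite tensor_piN; apply: PN.
Qed.

Lemma tensor_scaleA a b t : tensor_scale a (tensor_scale b t) = tensor_scale (a * b) t.
Proof.
elim/tensor_ind: t => [|s t IHs IHt|t IHt|m c]; first by rewrite !tensor_scale0.
- by rewrite !tensor_scaleDr IHs IHt.
- by rewrite !tensor_scaleN IHt.
- by rewrite !tensor_scale_pure mulrA.
Qed.

Lemma tensor_scale1 : left_id 1 tensor_scale.
Proof.
elim/tensor_ind=> [|s t IHs IHt|t IHt|m c]; first by rewrite tensor_scale0.
- by rewrite tensor_scaleDr IHs IHt.
- by rewrite tensor_scaleN IHt.
- by rewrite tensor_scale_pure mul1r.
Qed.

Lemma tensor_scaleDl t : {morph tensor_scale^~ t : a b / a + b}.
Proof.
move=> a b; elim/tensor_ind: t => [|s t IHs IHt|t IHt|m c] /=.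
- by rewrite !tensor_scale0 addr0.
- by rewrite !tensor_scaleDr IHs IHt addrACA.
- by rewrite !tensor_scaleN IHt opprD.
- by rewrite !tensor_scale_pure mulrDl pure_tensorDr.
Qed.

HB.instance Definition _ := GRing.Zmodule_isLmodule.Build B tensor
  tensor_scaleA tensor_scale1 tensor_scaleDr tensor_scaleDl.

(* the extension I B of an ideal of A to B *)
Definition ideal_ext (I : set A) : set B := ideal_gen [set a%:A | a in I].

End BaseChange.
Arguments tensor {A} M B.
Arguments ideal_ext {A} B I.

Section PolynomialGrade.
Context (A : comNzRingType).

Definition poly_ring (n : nat) : comAlgType A := mpoly n A.

Definition poly_grade (K : realType) (I : set A) (M : lmodType A) (n : nat) : \bar K :=
  grade K (ideal_ext (poly_ring n) I) (tensor M (poly_ring n)).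

(* [limn] takes a default value on divergent sequences. This one
   always converges: adding variables is a free extension, which keeps weak
   sequences weak, so the grades are nondecreasing in n. *)
Definition p_grade (K : realType) (I : set A) (M : lmodType A) : \bar K :=
  limn (poly_grade K I M).

End PolynomialGrade.

Definition QmodZ := quotmod (range (intr : int -> zmodule rat)).

HB.instance Definition _ := GRing.Lmodule.on QmodZ.

Definition QmodZ_pi (q : rat) : QmodZ := quotmod_pi _ (q : zmodule rat).

(* { a / 2^n + Z } as a subgroup of Q / Z *)
Definition prufer2_pred : {pred QmodZ} := fun x =>
  `[< exists (a : int) (n : nat), x = QmodZ_pi (a%:~R / 2 ^+ n) >].

Lemma prufer2_closed : GRing.submod_closed prufer2_pred.
Proof.
split=> [|c x y /asboolP[a [m ->]] /asboolP[b [n ->]]]; apply/asboolP.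
  exists 0, 0%N; rewrite mul0r; apply: (@addrI _ (QmodZ_pi 0)).
  by rewrite /QmodZ_pi -quotmod_piD !addr0.
exists (c * a * 2 ^+ n + b * 2 ^+ m), (m + n)%N.
have -> : ((c * a * 2 ^+ n + b * 2 ^+ m)%:~R / 2 ^+ (m + n) : rat) =
    (a%:~R / 2 ^+ m) *~ c + b%:~R / 2 ^+ n.
  have n0 k : (2 ^+ k : rat) != 0 by rewrite expf_neq0.
  rewrite -mulrzl intrD !intrM !rmorphXn /= exprD.
  by field; rewrite !n0.
by rewrite /QmodZ_pi quotmod_piD -quotmod_scaleE.
Qed.

HB.instance Definition _ :=
  GRing.isSubmodClosed.Build int QmodZ prufer2_pred prufer2_closed.

Definition prufer2 := {x : QmodZ | x \in prufer2_pred}.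

HB.instance Definition _ := SubChoice.on prufer2.
HB.instance Definition _ := [SubChoice_isSubZmodule of prufer2 by <:].
HB.instance Definition _ := [SubZmodule_isSubLmodule of prufer2 by <:].

(* Main.v *)
(* A nonzero element of M killed by I stays nonzero in every M[X_1, ..., X_n],
   where the coefficient of 1 retracts it, and is killed there by the extension
   of I; so no element of the extension is a non-zero-divisor and every grade
   is 0. The class of 1/2 is such an element of the divisible Prufer group. *)
Require Import Defs.
From HB Require Import structures.
From mathcomp Require Import all_boot all_order all_algebra.
From mathcomp Require Import boolp classical_sets.
From mathcomp Require Import reals ereal topology normedtype sequences.
From mathcomp.multinomials Require Import freeg.
From mathcomp.multinomials Require mpoly.
Import -(notations) mpoly.
Set Implicit Arguments.
Unset Strict Implicit.
Unset Printing Implicit Defensive.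
Import Order.TTheory GRing.Theory Num.Theory.
Local Open Scope ring_scope.
Local Open Scope classical_set_scope.

(** Used below to place a span inside a kernel, an annihilator or an ideal without handling explicit
    linear combinations. *)
Lemma submod_gen_ind (R : pzRingType) (V : lmodType R) (X : set V)
    (P : V -> Prop) :
  P 0 -> (forall u v, P u -> P v -> P (u + v)) ->
  (forall a v, P v -> P (a *: v)) -> X `<=` P -> submod_gen X `<=` P.
Proof.
move=> P0 PD PZ XP _ [n [a [x [Xx ->]]]].
by elim/big_ind: _ => // i _; apply/PZ/XP/Xx.
Qed.

Lemma quotmod_pi0 (R : pzRingType) (V : lmodType R) (X : set V) :
  quotmod_pi X 0 = 0.
Proof. by apply: (@addrI _ (quotmod_pi X 0)); rewrite -quotmod_piD !addr0. Qed.

Lemma quotmod_pi_eq0 (R : pzRingType) (V : lmodType R) (X : set V) v :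
  quotmod_pi X v = 0 <-> submod_gen X v.
Proof. by rewrite -{2}[v]subr0 -quotmod_eqP quotmod_pi0. Qed.

Lemma submod_gen_zero (R : pzRingType) (V : lmodType R) (X : set V) :
  X `<=` [set 0] -> submod_gen X `<=` [set 0].
Proof.
by apply: submod_gen_ind => //= [u v -> ->|a v ->]; rewrite ?addr0 ?scaler0.
Qed.

Section GradeZero.
Context (K : realType).

(** The first entry of a nonempty weak sequence in [J] would be a non-zero-divisor on [N], yet it
    kills [x]. Only the empty sequence remains, of length 0. *)
Lemma grade_eq0 (R : comNzRingType) (J : set R) (N : lmodType R) (x : N) :
  x <> 0 -> (forall r, J r -> r *: x = 0) -> grade K J N = 0%E.
Proof.
move=> x0 Jx0; rewrite /grade.
suff -> : [set s : seq R | [set` s] `<=` J /\ weak_sequence N s] = [set [::]].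
  by rewrite image_set1 ereal_sup1.
apply/seteqP; split=> [[|r s] [sJ ws]|_ ->] //; case: x0.
(* The first entry acts on a formal quotient of [N], by the span of products with the ideal of the
   empty sequence. That span is 0, so [x] vanishes once its class does. *)
pose X := smul_set (ideal_gen [set` take 0 (r :: s)]) N.
apply: (@submod_gen_zero _ _ X).
  move=> _ [a Ia [z _ <-]].
  have -> : a = 0 by apply: submod_gen_zero Ia => y.
  exact: scale0r.
apply/quotmod_pi_eq0/(ws 0%N isT).
have -> : (r :: s)`_0 *: quotmod_pi X x = quotmod_pi X (r *: x).
  exact: quotmod_scaleE.
by rewrite Jx0 ?quotmod_pi0 //; apply: sJ; rewrite /= mem_head.
Qed.

(** The A-linear form [f] induces an additive map from the tensor product to [M] sending
    [pure_tensor m b] to [f b *: m]. Its lift [h] to the free abelian group kills the bilinearity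
    relations. *)
Lemma pure_tensor_eq0 (A : comNzRingType) (M : lmodType A) (B : comAlgType A)
    (f : {linear B -> A | *%R}) (m : M) (b : B) :
  pure_tensor m b = 0 -> f b *: m = 0.
Proof.
pose g (p : M * B) : zmodule M := f p.2 *: p.1.
pose h : {freeg (M * B)%type} -> zmodule M := fglift g.
have hB : {morph h : x y / x - y} by exact: lift_is_additive.
have h0 : h 0 = 0 by rewrite -[X in h X](subrr 0) hB subrr.
have hN x : h (- x) = - h x by rewrite -[- x]sub0r hB h0 sub0r.
have hD x y : h (x + y) = h x + h y by rewrite -{1}[y]opprK hB hN opprK.
have hU p : h << p >> = g p by rewrite /h liftU scale1r.
move=> /quotmod_pi_eq0 Rmb; rewrite -[LHS](hU (m, b)).
apply: (@submod_gen_ind _ _ _ (fun v => h v = 0) _ _ _ _ _ Rmb)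
    => // [u v hu hv|a v hv|].
- by rewrite hD hu hv addr0.
(* The scalars of the span are integers, so additivity of [h] suffices. *)
- have hn n : h (v *+ n) = 0.
    by elim: n => [|n IHn]; rewrite ?mulr0n // mulrS hD hv IHn addr0.
  rewrite -[a]intz scaler_int; case: a => n; first exact: hn.
  by rewrite NegzE mulrNz hN hn oppr0.
- move=> _ [m1 m2 c|m1 c c'|a m1 c]; rewrite hB ?hD !hU /g /=.
  + by rewrite scalerDr; exact: subrr.
  + by rewrite (raddfD f) scalerDl; exact: subrr.
  + by rewrite (linearZ_LR f) scalerA mulrC; exact: subrr.
Qed.

Lemma poly_grade_eq0 (A : comNzRingType) (I : set A) (M : lmodType A) (m : M) n :
  m <> 0 -> (forall a, I a -> a *: m = 0) -> poly_grade K I M n = 0%E.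
Proof.
move=> m0 Im0; pose B := poly_ring A n.
apply: (@grade_eq0 _ _ _ (pure_tensor m (1 : B))) => [/= pm0|r].
  (* The constant coefficient is A-linear and sends 1 to 1. *)
  apply: m0; have := @pure_tensor_eq0 _ _ B (mcoeff mnm0) _ _ pm0.
  by rewrite /= mcoeff1 eqxx scale1r.
(* The annihilator of [pure_tensor m 1] is an ideal, so only generators [a%:A] matter; there [a]
   crosses the tensor sign and kills [m]. *)
pose P (r : B^o) := (r : B) *: pure_tensor m (1 : B) = 0.
move: r; apply: (@submod_gen_ind _ _ _ P)
  => [|u v hu hv|b v hv|_ [a Ia <-]]; rewrite /P.
- exact: scale0r.
- by rewrite scalerDl hu hv addr0.
- by rewrite -[b *: v]/(b * v) -scalerA hv scaler0.
- have -> : a%:A *: pure_tensor m (1 : B) = pure_tensor m (a%:A * 1).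
    exact: tensor_scale_pure.
  rewrite mulr1 -pure_tensorZ Im0 //.
  by apply: (@addrI _ (pure_tensor 0 (1 : B))); rewrite -pure_tensorDl !addr0.
Qed.

End GradeZero.

Lemma QmodZ_pi_eq0 (q : rat) : QmodZ_pi q = 0 <-> exists k : int, q = k%:~R.
Proof.
rewrite quotmod_pi_eq0; split=> [|[k ->]]; last by apply: submod_gen_sub; exists k.
move: q; apply: (@submod_gen_ind _ _ _
  (fun q : zmodule rat => exists k : int, (q : rat) = k%:~R)).
- by exists 0.
- by move=> _ _ [k ->] [l ->]; exists (k + l); rewrite intrD.
- by move=> a _ [k ->]; exists (k * a); rewrite intrM mulrzr.
- by move=> _ [k _ <-]; exists k.
Qed.

Lemma QmodZ_piZ (a : int) (q : rat) : a *: QmodZ_pi q = QmodZ_pi (a%:~R * q).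
Proof. by rewrite mulrzl; exact: quotmod_scaleE. Qed.

Lemma prufer2_pi_subproof (a : int) (n : nat) :
  QmodZ_pi (a%:~R / 2 ^+ n) \in prufer2_pred.
Proof. by apply/asboolP; exists a, n. Qed.

Definition prufer2_pi (a : int) (n : nat) : prufer2 :=
  exist (fun x => x \in prufer2_pred) _ (prufer2_pi_subproof a n).

Lemma prufer2_half_neq0 : prufer2_pi 1 1 <> 0.
Proof.
move=> /(congr1 val); rewrite raddf0 => /QmodZ_pi_eq0[k].
(* Doubling turns 1/2 = k into 1 = 2k over the integers, impossible modulo 2. *)
move=> /(congr1 ( *%R 2%:~R)); rewrite mulrCA mulfV // -!intrM.
move=> /(@intr_inj rat 1).
by move=> /(congr1 (fun z => (z %% 2)%Z)); rewrite [2 * k]mulrC modzMl.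
Qed.

Lemma prufer2_halfK : 2 *: prufer2_pi 1 1 = 0.
Proof.
apply: val_inj; rewrite linearZ raddf0 /= QmodZ_piZ.
by apply/QmodZ_pi_eq0; exists 1; rewrite mulrCA mulfV.
Qed.

(** Halving a/2^n only raises the exponent of the denominator. *)
Lemma prufer2_divisible (x : prufer2) : exists y : prufer2, x = 2 *: y.
Proof.
have /asboolP[a [n xE]] := valP x.
exists (prufer2_pi a n.+1); apply: val_inj; rewrite linearZ /= QmodZ_piZ xE.
by congr QmodZ_pi; rewrite exprS invfM mulrCA mulVKf.
Qed.

Theorem mainTheorem2 (K : realType) :
  (~ (forall (A : comNzRingType) (I : set A) (M : lmodType A),
        fg_ideal I ->
        ((p_grade K I M < +oo)%E <-> ideal_smul I M <> [set: M])))
  /\ (let I : set int := [set 2 * k | k in [set: int]] in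
      [/\ fg_ideal I,
          ideal_smul I prufer2 = [set: prufer2],
          cvgn (poly_grade K I prufer2) &
          p_grade K I prufer2 = 0%E]).
Proof.
pose I : set int := [set 2 * k | k in [set: int]].
have Ifg : fg_ideal I.
  exists [:: 2]; apply/seteqP; split=> [_ [k _ <-]|].
    by rewrite mulrC; apply/submod_genZ/submod_gen_sub; rewrite /= mem_head.
  apply: (@submod_gen_ind _ int^o _ I)
    => [|_ _ [k _ <-] [l _ <-]|a _ [k _ <-]|k].
  - by exists 0.
  - by exists (k + l); rewrite ?mulrDr.
  - by exists (a * k); rewrite // mulrCA.
  - by rewrite /= inE => /eqP ->; exists 1.
have IT : ideal_smul I prufer2 = [set: prufer2].
  apply/seteqP; split=> // x _; have [y ->] := prufer2_divisible x.
  by apply: submod_gen_sub; exists 2; [exists 1 | exists y].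
(* The grades are constantly 0, which settles both convergence and the limit. *)
have I0 : poly_grade K I prufer2 = fun=> 0%E.
  apply/funext => n; apply: (poly_grade_eq0 _ _ prufer2_half_neq0) => _ [k _ <-].
  by rewrite mulrC -scalerA prufer2_halfK scaler0.
have p0 : p_grade K I prufer2 = 0%E by rewrite /p_grade I0 lim_cst.
split; last by split; rewrite // I0; exact: is_cvg_cst.
(* The direction that fails is from finite p-grade to [IM <> M]. *)
by move=> /(_ _ _ prufer2 Ifg)[+ _]; rewrite p0 ltry => /(_ isT)/(_ IT).
Qed.
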